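(* Let $\mathbf{L}$ be a complete De Morgan Heyting algebra and $U$ a set. Let $\mathcal{U}$ be an $L$-fuzzy operator on $U$ and let $\mathcal{S}_1,\dots,\mathcal{S}_n$ and $\mathcal{T}_1,\dots,\mathcal{T}_m$ be $L$-fuzzy operators on $U$ such that $\mathcal{U}\leq\mathcal{S}_j$ for every $1\leq j\leq n$ and $\mathcal{U}\geq\mathcal{T}_k$ for every $1\leq k\leq m$. Then there exists a unique $L$-relation $R$ on $U$ such that $\mathsf{U}_R(A)=\mathcal{U}(A)$ for all $A\in\mathcal{F}_L(U)$ if and only if $$\mathcal{U}\Big(\overline{a}\wedge\bigvee_{i\in I} A_i\Big)=\overline{a}\wedge\bigvee_{i\in I}\Big(\big(\mathcal{U}(A_i)\wedge\mathcal{S}_1(A_i)\wedge\cdots\wedge\mathcal{S}_n(A_i)\big)\vee\big(\mathcal{T}_1(A_i)\vee\cdots\vee\mathcal{T}_m(A_i)\big)\Big)$$ for all $a\in L$ and all families $\{A_i\}_{i\in I}\subseteq\mathcal{F}_L(U)$.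
   Context: A De Morgan Heyting algebra is an algebra $\mathbf{L}=(L,\vee,\wedge,\Rightarrow,{}',0,1)$ such that $(L,\vee,\wedge,\Rightarrow,0,1)$ is a Heyting algebra and $'$ satisfies $(x\wedge y)'=x'\vee y'$ and $x''=x$ for all $x,y\in L$. It is called complete if its underlying lattice is complete. An $L$-set on $U$ is a map $A\colon U\to L$; $\mathcal{F}_L(U)$ is the set of all $L$-sets on $U$, with order, $\wedge$, $\vee$ and $\bigvee$ defined pointwise. An $L$-relation on $U$ is a map $R\colon U\times U\to L$, and its upper $L$-approximation operator is $\mathsf{U}_R(A)(x)=\bigvee_{y\in U}(R(x,y)\wedge A(y))$. For $a\in L$, $\overline{a}\in\mathcal{F}_L(U)$ is the constant map with value $a$. An $L$-fuzzy operator on $U$ is any map $\mathcal{F}_L(U)\to\mathcal{F}_L(U)$; inequalities between operators mean the inequality holds at every $A\in\mathcal{F}_L(U)$. *)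

(* Defs.v *)
From HB Require Import structures.
From mathcomp Require Import all_boot all_order.
From mathcomp Require Import boolp classical_sets functions.

Set Implicit Arguments.
Unset Strict Implicit.
Unset Printing Implicit Defensive.

Import Order.TTheory.
Local Open Scope classical_set_scope.
Local Open Scope order_scope.

HB.mixin Record isHeyting (d : Order.disp_t) L & Order.TBLattice d L := {
  himp : L -> L -> L;
  himpP : forall x y z : L, (z <= himp x y) = (x `&` z <= y)
}.

#[short(type="heytingType")]
HB.structure Definition Heyting (d : Order.disp_t) :=
  { L of isHeyting d L & Order.TBLattice d L }.

HB.mixin Record isDeMorgan (d : Order.disp_t) L & Order.TBLattice d L := {
  dmneg : L -> L;
  dmnegI : forall x y : L, dmneg (x `&` y) = dmneg x `|` dmneg y;
  dmnegK : forall x : L, dmneg (dmneg x) = x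
}.

#[short(type="deMorganHeytingType")]
HB.structure Definition DeMorganHeyting (d : Order.disp_t) :=
  { L of isDeMorgan d L & Heyting d L }.

HB.mixin Record isCompleteLattice (d : Order.disp_t) L & Order.TBLattice d L := {
  supremums_neq0 : forall A : set L, supremums A !=set0;
  infimums_neq0 : forall A : set L, infimums A !=set0
}.

#[short(type="completeDeMorganHeytingType")]
HB.structure Definition CompleteDeMorganHeyting (d : Order.disp_t) :=
  { L of isCompleteLattice d L & DeMorganHeyting d L }.

(* The default value [\bot] makes this the least upper bound for empty [I]
   as well. *)
Definition ijoin (d : Order.disp_t) (L : completeDeMorganHeytingType d)
    (I : Type) (a : I -> L) : L :=
  supremum \bot (range a).

(* MathComp already provides the pointwise order, meet and join on [U -> L];
   only the bounds are missing. *)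
Section PointwiseBounds.
Context {U : Type} {d : Order.disp_t} {L : tbLatticeType d}.

Fact le0f (A : U -> L) : cst \bot <= A.
Proof. by apply/lefP => x; exact: le0x. Qed.

Fact lef1 (A : U -> L) : A <= cst \top.
Proof. by apply/lefP => x; exact: lex1. Qed.

HB.instance Definition _ := Order.hasBottom.Build _ (U -> L) le0f.
HB.instance Definition _ := Order.hasTop.Build _ (U -> L) lef1.
End PointwiseBounds.

Section LSets.
Context {d : Order.disp_t} {L : completeDeMorganHeytingType d} {U : Type}.

Definition lset_ijoin (I : Type) (A : I -> U -> L) : U -> L :=
  fun x => ijoin (fun i => A i x).

Definition upper_approx (R : U -> U -> L) (A : U -> L) : U -> L :=
  fun x => ijoin (fun y => R x y `&` A y).

End LSets.

(* Main.v *)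
(** An upper approximation operator commutes with arbitrary joins and with
    meets by constants, since meet distributes over arbitrary joins in a
    complete Heyting algebra. Conversely [R] is read off from the values on
    crisp singletons, [R x y = Uop {y} x], because every [L]-set is the join
    [A = \/_y (A y /\ {y})]; this also gives uniqueness. The bounds
    [T_k <= Uop <= S_j] collapse the right-hand side of the identity to
    [a /\ \/_i Uop (A_i)]. *)
Require Import Defs.
From mathcomp Require Import all_boot all_order.
From mathcomp Require Import boolp classical_sets functions.

Local Open Scope order_scope.

Import Order.TTheory.

Section IndexedJoins.
Context {d : Order.disp_t} {L : completeDeMorganHeytingType d}.

Lemma ijoin_ge {I : Type} (a : I -> L) (i : I) : a i <= ijoin a.
Proof.
have [s [sub slb]] := supremums_neq0 (range a).
(* The index [i] rules out the empty range, so the default value is never reached here. *)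
rewrite /ijoin /supremum; case: ifPn => [/eqP a0|_].
  have : range a (a i) by exists i.
  by rewrite a0.
by case: xgetP => [y _ [yub _]|/(_ s)[]//]; apply: yub; exists i.
Qed.

Lemma ijoin_leP {I : Type} (a : I -> L) (z : L) :
  (ijoin a <= z) <-> (forall i, a i <= z).
Proof.
split=> [le_z i|az]; first exact: le_trans (ijoin_ge a i) le_z.
have [s [sub slb]] := supremums_neq0 (range a).
(* For an empty range the default [\bot] lies below every [z]. *)
rewrite /ijoin /supremum; case: ifPn => [_|_]; first exact: le0x.
case: xgetP => [y _ [_ ylb]|/(_ s)[]//].
by apply: ylb => _ [i _ <-].
Qed.

(** By residuation, meeting with [b] is left adjoint to [himp b], so it preserves joins. *)
Lemma meet_ijoin {I : Type} (b : L) (a : I -> L) :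
  b `&` ijoin a = ijoin (fun i => b `&` a i).
Proof.
apply/eqP; rewrite eq_le -himpP; apply/andP; split.
  by apply/ijoin_leP => i; rewrite himpP; exact: (ijoin_ge (fun i => b `&` a i)).
by apply/ijoin_leP => i; exact: leI2 (lexx b) (ijoin_ge a i).
Qed.

Lemma exchange_ijoin {I J : Type} (a : I -> J -> L) :
  ijoin (fun i => ijoin (a i)) = ijoin (fun j => ijoin (fun i => a i j)).
Proof.
apply/eqP; rewrite eq_le; apply/andP; split; apply/ijoin_leP => i;
  apply/ijoin_leP => j.
- apply: le_trans (ijoin_ge (fun j => ijoin (fun i => a i j)) j).
  exact: (ijoin_ge (fun i => a i j)).
- apply: le_trans (ijoin_ge (fun i => ijoin (a i)) j).
  exact: (ijoin_ge (a j)).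
Qed.

Lemma ijoin_unit (a : unit -> L) : ijoin a = a tt.
Proof.
apply/eqP; rewrite eq_le (ijoin_ge a) andbT.
by apply/ijoin_leP => -[].
Qed.

End IndexedJoins.

Section UpperApproximation.
Context {d : Order.disp_t} {L : completeDeMorganHeytingType d} {U : Type}.

(** Equality is decided classically, as [U] is an arbitrary type. *)
Definition crisp1 (y : U) : U -> L :=
  fun z => if `[< z = y >] then \top else \bot.

Lemma ijoin_meet_crisp1 (A : U -> L) (x : U) :
  ijoin (fun y => A y `&` crisp1 y x) = A x.
Proof.
apply/eqP; rewrite eq_le; apply/andP; split.
  apply/ijoin_leP => y; rewrite /crisp1; case: asboolP => [->|_].
    by rewrite meetx1.
  by rewrite meetx0 le0x.
apply: le_trans (ijoin_ge (fun y => A y `&` crisp1 y x) x).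
by rewrite /crisp1; case: asboolP => // _; rewrite meetx1.
Qed.

Lemma upper_approx_crisp1 (R : U -> U -> L) (x y : U) :
  upper_approx R (crisp1 y) x = R x y.
Proof.
rewrite /upper_approx -[RHS](ijoin_meet_crisp1 (R x)); congr ijoin.
apply/funext => z; congr (_ `&` _); rewrite /crisp1.
(* The two joins differ only by the symmetry of [crisp1] in its two points. *)
by congr (if _ then _ else _); apply: asbool_equiv_eq; split=> ->.
Qed.

Lemma upper_approx_meet_ijoin (R : U -> U -> L) (a : L) {I : Type}
    (A : I -> U -> L) :
  upper_approx R (cst a `&` lset_ijoin A) =
  cst a `&` lset_ijoin (fun i => upper_approx R (A i)).
Proof.
apply/funext => x; rewrite meetfE /upper_approx /lset_ijoin exchange_ijoin.
rewrite meet_ijoin; congr ijoin; apply/funext => y.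
by rewrite meetfE meetCA -meet_ijoin.
Qed.

Lemma upper_approx_of_meet_ijoin (F : (U -> L) -> (U -> L)) :
  (forall (a : L) (I : Type) (A : I -> U -> L),
     F (cst a `&` lset_ijoin A) = cst a `&` lset_ijoin (fun i => F (A i))) ->
  forall A, upper_approx (fun x y => F (crisp1 y) x) A = F A.
Proof.
move=> FMJ A.
(* A one-element family isolates compatibility with constants. *)
have FM a B : F (cst a `&` B) = cst a `&` F B.
  have unitE (C : U -> L) : lset_ijoin (fun _ : unit => C) = C.
    by apply/funext => x; exact: ijoin_unit.
  by rewrite -[in LHS](unitE B) FMJ unitE.
(* The constant [\top] isolates preservation of joins. *)
have FJ I (B : I -> U -> L) : F (lset_ijoin B) = lset_ijoin (fun i => F (B i)).
  have topE (C : U -> L) : cst \top `&` C = C.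
    by apply/funext => x; rewrite meetfE meet1x.
  by rewrite -[lset_ijoin B]topE FMJ topE.
(* Only the argument of [F] is expanded; [FJ] and [FM] then pull out the join and the coefficients
   [A y]. *)
have {2}-> : A = lset_ijoin (fun y => cst (A y) `&` crisp1 y).
  apply/funext => x; rewrite /lset_ijoin -[LHS]ijoin_meet_crisp1.
  by congr ijoin; apply/funext => y; rewrite meetfE.
rewrite FJ; apply/funext => x; congr ijoin; apply/funext => y.
by rewrite FM meetfE meetC.
Qed.

End UpperApproximation.

(** Absorption, applied twice. It covers [n = 0] and [m = 0]: the empty meet is [\top] and the empty
    join is [\bot]. *)
Lemma meet_meets_join_joins {d : Order.disp_t} {L : tbLatticeType d} {n m : nat}
    (u : L) (s : 'I_n -> L) (t : 'I_m -> L) :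
  (forall j, u <= s j) -> (forall k, t k <= u) ->
  (u `&` \meet_(j < n) s j) `|` \join_(k < m) t k = u.
Proof.
move=> us tu; rewrite meet_l ?join_l //; first by apply/joinsP => k _.
by apply/meetsP => j _.
Qed.

Theorem theorem4p8 (d : Order.disp_t) (L : completeDeMorganHeytingType d)
    (U : Type) (Uop : (U -> L) -> (U -> L))
    (n m : nat)
    (S : 'I_n -> (U -> L) -> (U -> L))
    (T : 'I_m -> (U -> L) -> (U -> L))
    (leUS : forall (j : 'I_n) (A : U -> L), Uop A <= S j A)
    (leTU : forall (k : 'I_m) (A : U -> L), T k A <= Uop A) :
  (exists! R : U -> U -> L, forall A : U -> L, upper_approx R A = Uop A)
  <->
  (forall (a : L) (I : Type) (A : I -> U -> L),
     Uop (cst a `&` lset_ijoin A) =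
     cst a `&`
       lset_ijoin (fun i =>
         (Uop (A i) `&` \meet_(j < n) S j (A i)) `|` \join_(k < m) T k (A i))).
Proof.
have collapse I (A : I -> U -> L) :
    (fun i => (Uop (A i) `&` \meet_(j < n) S j (A i)) `|`
              \join_(k < m) T k (A i)) = (fun i => Uop (A i)).
  (* Absorption is used in the lattice [U -> L] itself, with its pointwise bounds. *)
  by apply/funext => i; exact: meet_meets_join_joins.
split=> [[R [RU _]] a I A|UMJ].
  rewrite collapse -RU upper_approx_meet_ijoin; congr (_ `&` lset_ijoin _).
  by apply/funext => i; rewrite RU.
exists (fun x y => Uop (crisp1 y) x); split.
  by apply: upper_approx_of_meet_ijoin => a I A; rewrite UMJ collapse.
move=> R RU; apply/funext => x; apply/funext => y.
by rewrite -RU upper_approx_crisp1.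
Qed.
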